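(* Let $D$ be the open unit disc and let $J\subsetneq\partial D$ be a relatively open subset of the unit circle. The set of functions $f\in A(D,J)$ such that $\operatorname{Re}f|_J$ and $\operatorname{Im}f|_J$ are not differentiable with respect to the parameter $\theta\in\mathbb{R}$ at any point $z=e^{i\theta}\in J$ contains a $G_\delta$ and dense subset of $A(D,J)$.
   Context: $A(D,J)$ is the set of holomorphic functions $f:D\to\mathbb{C}$ which extend continuously to $D\cup J$ (the extension is also denoted by $f$), endowed with the Fréchet topology induced by the seminorms $\|f|_{\Delta_m}\|_\infty=\sup_{z\in\Delta_m}|f(z)|$, $m=1,2,\dots$, where $\Delta_m=\{z\in D\cup J:\operatorname{dist}(z,\partial D\setminus J)\ge\frac1m\}$. Differentiability of $u:J\to\mathbb{R}$ with respect to $\theta$ at $e^{i\theta_0}\in J$ means differentiability of $\theta\mapsto u(e^{i\theta})$ at $\theta_0$. *)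

(* Defs.v *)
From HB Require Import structures.
From mathcomp Require Import all_boot all_order all_algebra.
From mathcomp Require Import all_classical all_reals all_analysis.
From mathcomp Require Import complex borel_hierarchy.

Set Implicit Arguments.
Unset Strict Implicit.
Unset Printing Implicit Defensive.

Import Order.TTheory GRing.Theory Num.Theory.
Import numFieldNormedType.Exports.

Local Open Scope classical_set_scope.
Local Open Scope ring_scope.
Local Open Scope complex_scope.

Import Normc.

(* R[i] is normed over itself, so that "derivable f z 1" below is complex
   differentiability. *)
HB.instance Definition _ (R : realType) := GRing.ComAlgebra.copy R[i] R[i]^o.
HB.instance Definition _ (R : realType) := Vector.copy R[i] R[i]^o.
HB.instance Definition _ (R : realType) := NormedModule.copy R[i] R[i]^o.

Section DiscAlgebra.
Context {R : realType}.
Implicit Types (J : set R[i]) (h : R[i] -> R[i]) (m : nat).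

Definition unit_disc : set R[i] := [set z | `|z| < 1].

Definition unit_circle : set R[i] := [set z | `|z| = 1].

Definition relatively_open (A J : set R[i]) :=
  exists2 U : set R[i], open U & J = A `&` U.

Definition eitheta (theta : R) : R[i] := cos theta +i* sin theta.

(* Real-valued distance to A; the value is junk (0) when A is empty. *)
Definition dist (z : R[i]) (A : set R[i]) : R :=
  inf [set normc (z - w) | w in A].

(* A function on the disc together with J is encoded as a total function that
   vanishes elsewhere.  As the continuous extension to J is unique, each element
   of A(D,J) has exactly one such encoding. *)
Definition in_ADJ J : set (R[i] -> R[i]) :=
  [set f | [/\ forall z, unit_disc z -> derivable f z 1,
               {within unit_disc `|` J, continuous f} &
               forall z, ~ (unit_disc `|` J) z -> f z = 0]].

Definition ADJ J : Type := set_type (in_ADJ J).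

HB.instance Definition _ J := Choice.on (ADJ J).

Definition ADJ_fun J (f : ADJ J) : R[i] -> R[i] := \val f.

Definition Delta J m : set R[i] :=
  [set z | (unit_disc `|` J) z /\ m%:R^-1 <= dist z (unit_circle `\` J)].

Definition seminorm J m h : R := sup [set normc (h z) | z in Delta J m].

Definition seminorm_ball J m (f : ADJ J) (e : R) : set (ADJ J) :=
  [set g | seminorm J m (ADJ_fun g \- ADJ_fun f) < e].

Definition seminorm_balls J : set (set (ADJ J)) :=
  [set B | exists m (f : ADJ J) (e : R),
     [/\ (0 < m)%N, 0 < e & B = seminorm_ball m f e]].

(* The coarsest topology in which all the balls of the seminorms are open. *)
HB.instance Definition _ J :=
  isSubBaseTopological.Build (ADJ J) (@seminorm_balls J) id.

Definition nowhere_differentiable_on J (u : R[i] -> R) :=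
  forall theta : R, J (eitheta theta) -> ~ derivable (u \o eitheta) theta 1.

End DiscAlgebra.

(* Main.v *)
Require Import Defs.
From mathcomp Require Import all_boot all_order all_algebra.
From mathcomp Require Import all_classical all_reals all_analysis.
From mathcomp Require Import complex borel_hierarchy.
From mathcomp Require Import finmap ring lra.

Set Implicit Arguments.
Unset Strict Implicit.
Unset Printing Implicit Defensive.

Import Order.TTheory GRing.Theory Num.Theory.
Import numFieldNormedType.Exports.
Import Normc.

Local Open Scope classical_set_scope.
Local Open Scope ring_scope.
Local Open Scope complex_scope.

(** For f in A(D,J) and 0 < s < 1 the dilate z |-> f ((1 - s) z) is holomorphic
on a disc larger than D, and it tends to f uniformly on each Delta_m as s tends
to 0 (uniform continuity near the compact set Delta_m).  Being differentiable at each point of the circle, a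
dilate is locally Lipschitz there.  Adding to it s times a fixed function w,
continuous on the closed disc and holomorphic in the disc, whose real and
imaginary parts have unbounded difference quotients at every point of the
circle, gives functions that are still close to f and have unbounded
difference quotients everywhere on the circle ([perturb], [perturb_near],
[perturb_steep]).

For w one takes the lacunary series sum_k 2^-k z^(8^k) ([lacunary]).  Rotating
z by h = +-pi/(2*8^k) multiplies z^(8^k) by +-i and fixes all later terms,
since 4*8^k divides 8^j for j > k.  The term of index k then moves the real
part by at least 2^-k for one of the two signs, while the earlier terms
together move it by at most |h| 4^k / 3.  As |h| <= 2/8^k, the difference
quotient is at least 4^k / 6 ([lacunary_steep]).

The dense G_delta set is the intersection over n of the sets of functions with
the following property, for the real and for the imaginary part: at each point
of the circle in Delta_n some rotation by less than 1/(2n) produces a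
difference quotient larger than n, with a margin that does not depend on the
point ([steep_set]).  The margin makes these sets open.  The perturbed dilates
lie in all of them at once (compactness of the circle turns pointwise steepness
into a uniform margin), so density of the whole intersection follows at
once from the first paragraph.  A function in all of them is differentiable at no point of
J, because J is covered by the Delta_n ([steep_nowhere_differentiable]).

Real and imaginary parts are treated together by looking at Re (a f) with a
unimodular constant a: the values a = 1 and a = -i give Re f and Im f. *)

(** * Metric form of nearness, continuity and complex differentiability *)

Section MetricForm.
Context {R : realType}.
Implicit Types (z w y : R[i]) (f : R[i] -> R[i]).

Lemma normc_normr z : `|z| = (normc z)%:C.
Proof. by []. Qed.

Lemma normc_ge0 z : 0 <= normc z.
Proof. by case: z => a b; exact: sqrtr_ge0. Qed.

Lemma ReD z w : complex.Re (z + w) = complex.Re z + complex.Re w.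
Proof. by case: z w => ? ? []. Qed.

Lemma ReZ (x : R) z : complex.Re (x%:C * z) = x * complex.Re z.
Proof. by case: z => ? ? /=; rewrite mul0r subr0. Qed.

Lemma ReN z : complex.Re (- z) = - complex.Re z.
Proof. by case: z. Qed.

Lemma ler_normcD z w : normc (z + w) <= normc z + normc w.
Proof. exact: le_normcD. Qed.

Lemma normc_distC z w : normc (z - w) = normc (w - z).
Proof. by rewrite -normcN opprB. Qed.

Lemma ler_normc_dist z w y : normc (z - y) <= normc (z - w) + normc (w - y).
Proof. by apply: le_trans (ler_normcD _ _); rewrite addrA subrK. Qed.

Lemma normc_real (a : R) : normc a%:C = `|a|.
Proof. by rewrite /= expr0n addr0 sqrtr_sqr. Qed.

Lemma normcX z n : normc (z ^+ n) = normc z ^+ n.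
Proof. by elim: n => [|n IH]; rewrite ?normc1// !exprS normcM IH. Qed.

Lemma ler_Re_normc z : `|complex.Re z| <= normc z.
Proof. by rewrite -lecR; exact: normc_ge_Re. Qed.

Lemma ler_Im_normc z : `|complex.Im z| <= normc z.
Proof.
case: z => a b /=; rewrite -sqrtr_sqr; apply: ler_wsqrtr.
by rewrite lerDr sqr_ge0.
Qed.

Lemma ler_normc_ReIm z : normc z <= `|complex.Re z| + `|complex.Im z|.
Proof.
case: z => a b /=.
rewrite -(ger0_norm (addr_ge0 (normr_ge0 a) (normr_ge0 b))) -sqrtr_sqr.
apply: ler_wsqrtr; rewrite sqrrD !real_normK ?num_real//.
have := mulr_ge0 (normr_ge0 a) (normr_ge0 b); lra.
Qed.

Lemma nbhs_normcP z (A : set R[i]) :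
  nbhs z A <-> exists2 e : R, 0 < e & forall w, normc (w - z) < e -> A w.
Proof.
split.
  move/nbhs_ballP => [e e0 eA].
  have /RRe_real eE : e \is Num.real by rewrite realE ltW.
  exists (complex.Re e); first by rewrite -ltcR eE.
  move=> w wz; apply: eA; rewrite /ball /= distrC normc_normr -eE ltcR //.
move=> [e e0 eA]; apply/nbhs_ballP; exists e%:C; first by rewrite /= ltcR.
by move=> w; rewrite /ball /= distrC normc_normr ltcR; exact: eA.
Qed.

Lemma within_continuous_normcP (A : set R[i]) f :
  {within A, continuous f} <->
  forall z, A z -> forall e : R, 0 < e -> exists2 d : R, 0 < d &
    forall y, A y -> normc (y - z) < d -> normc (f y - f z) < e.
Proof.
rewrite subspace_continuousP; split=> fC z Az.
  move=> e e0.
  have /fC : nbhs (f z) [set y | normc (y - f z) < e].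
     by apply/nbhs_normcP; exists e.
  move=> /(_ Az); rewrite /= /within /= => /nbhs_normcP[d d0 dA].
  by exists d => // y Ay yz; exact: dA.
move=> B /nbhs_normcP[e e0 eB].
have [d d0 dA] := fC z Az e e0.
rewrite /= /within /=; apply/nbhs_normcP; exists d => // y yz Ay.
by apply: eB; exact: dA.
Qed.

Lemma derivable_normcP f z :
  derivable f z 1 <->
  exists L : R[i], forall e : R, 0 < e -> exists2 d : R, 0 < d &
    forall y, normc (y - z) < d ->
      normc (f y - f z - (y - z) * L) <= e * normc (y - z).
Proof.
rewrite /derivable; split.
  move=> /cvg_ex[/= L fL]; exists L => e e0.
  have /fL : nbhs L [set y | normc (y - L) < e].
     by apply/nbhs_normcP; exists e.
  rewrite /= /dnbhs /within /= => /nbhs_normcP[d d0 dA].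
  exists d => // y yz.
  have [->|yNz] := eqVneq y z.
    by rewrite !subrr mul0r subr0 normc0 mulr0.
  have h0 : y - z != 0 by rewrite subr_eq0.
  have := dA (y - z); rewrite subr0 => /(_ yz h0).
  rewrite /GRing.scale /= mulr1 subrK => H.
  rewrite -(divfK h0 (f y - f z)) mulrC -mulrBr normcM mulrC.
  by rewrite ler_wpM2r ?normc_ge0// [_ / _]mulrC ltW.
move=> [L fL]; apply/cvg_ex; exists L => B /nbhs_normcP[e e0 eB].
have [d d0 dA] := fL (e / 2) ltac:(by rewrite divr_gt0).
rewrite /= /dnbhs /within /=; apply/nbhs_normcP; exists d => // h.
rewrite subr0 => hd h0; apply: eB.
have := dA (h + z); rewrite addrK => /(_ hd) H.
rewrite /GRing.scale /= mulr1.
have -> : h^-1 * (f (h + z) - f z) - L = h^-1 * (f (h + z) - f z - h * L).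
  by rewrite [RHS]mulrBr mulKf.
rewrite normcM normcV.
have h1 : 0 < normc h.
  by rewrite lt_neqAle normc_ge0 andbT eq_sym; apply: contra_neq h0;
    exact: eq0_normc.
rewrite mulrC ltr_pdivrMr//; apply: le_lt_trans H _.
by rewrite ltr_pM2r// ltr_pdivrMr// ltr_pMr// ltrDl.
Qed.
End MetricForm.

(** * The unit disc and the seminorms *)

Section DiscSeminorms.
Context {R : realType}.
Implicit Types (z w y : R[i]) (f g h : R[i] -> R[i]) (J K : set R[i]).

Lemma unit_discP z : unit_disc z <-> normc z < 1.
Proof. by rewrite /unit_disc /= normc_normr -ltcR. Qed.

Lemma unit_circleP z : unit_circle z <-> normc z = 1.
Proof.
rewrite /unit_circle /= normc_normr; split => [|->]; last by [].
by move=> /(@complexI R).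
Qed.

Lemma lipschitz_normc_continuous (g : R[i] -> R) :
  (forall z w, g z <= g w + normc (z - w)) -> continuous g.
Proof.
move=> gL z A /nbhs_ballP[e /= e0 eA].
rewrite /=; apply/nbhs_normcP; exists e => // w wz; apply: eA.
rewrite /ball /= ltr_norml.
have := gL z w; have := gL w z; rewrite [normc (z - w)]normc_distC; lra.
Qed.

Lemma normc_continuous : continuous (@normc R).
Proof.
apply: lipschitz_normc_continuous => z w.
by rewrite -{1}(subrK w z) addrC; exact: ler_normcD.
Qed.

Lemma compact_normc_le1 : compact [set z : R[i] | normc z <= 1].
Proof.
pose phi (p : R * R) := p.1 +i* p.2.
have phiC : continuous phi.
  move=> p A /nbhs_normcP[e e0 eA]; apply/nbhs_ballP; exists (e / 2) => /=.
    by rewrite divr_gt0.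
  move=> q [/= q1 q2]; apply: eA; rewrite /phi.
  apply: le_lt_trans (ler_normc_ReIm _) _ => /=.
  move: q1 q2; rewrite /ball /= distrC => q1; rewrite distrC => q2.
  by have := ltrD q1 q2; rewrite -splitr.
have Kphi : compact (phi @` (`[-1, 1] `*` `[-1, 1])).
  apply: continuous_compact; first exact: continuous_subspaceT.
  by apply: compact_setX; exact: segment_compact.
apply: subclosed_compact Kphi _.
  apply: (@closed_comp _ _ (@normc R) [set x | x <= 1]); last exact: closed_le.
  by move=> z _; exact: normc_continuous.
move=> z /= z1; exists (complex.Re z, complex.Im z); last by case: z z1.
by split; rewrite /= in_itv /= -ler_norml;
  [have := ler_Re_normc z | have := ler_Im_normc z]; move=> /le_trans; apply.
Qed.

Lemma compact_unit_circle : compact [set z : R[i] | normc z = 1].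
Proof.
have -> : [set z : R[i] | normc z = 1] = [set z | normc z <= 1] `&`
    (@normc R) @^-1` [set x | 1 <= x].
  rewrite eqEsubset; split=> z /= => [->//|[z1 z2]].
  by apply/eqP; rewrite eq_le z1.
apply: compact_closedI; first exact: compact_normc_le1.
by apply: closed_comp; [move=> z _; exact: normc_continuous|exact: closed_ge].
Qed.

(** Compactness in the form used below: a property of a point and of a small
positive parameter which holds locally near each point of K, for all small
parameters, holds on all of K for all small parameters. *)
Lemma compact_uniform_pos K (P : R -> R[i] -> Prop) : compact K ->
  (forall z, K z -> exists2 d : R, 0 < d &
    forall e y, 0 < e < d -> K y -> normc (y - z) < d -> P e y) ->
  exists2 d : R, 0 < d & forall e, 0 < e < d -> forall y, K y -> P e y.
Proof.
move=> /compact_near_coveringP/near_covering_withinP cK PK.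
have /cK H : Filter (0 : R)^'+ by exact: at_right_proper_filter.
have : \forall e \near 0^'+, K `<=` P e.
  apply: H => z /PK[d d0 dP].
  exists ([set y | normc (y - z) < d], [set e | 0 < e < d]) => /=.
    split; first by apply/nbhs_normcP; exists d.
    near=> e; apply/andP; split; near: e; first exact: nbhs_right_gt.
    exact: nbhs_right_lt.
  by move=> [y e] /= [yz ed] Ky; exact: dP.
rewrite /= /at_right /within /= => /nbhs_ballP[d /= d0 dP].
exists d => // e /andP[e0 ed] y Ky; apply: (dP e) => //.
by rewrite /ball /= sub0r normrN gtr0_norm.
Unshelve. all: by end_near. Qed.

Section Seminorms.
Variable J : set R[i].
Hypothesis J_sub : J `<=` unit_circle.
Hypothesis J_proper : J <> unit_circle.

Lemma circle_minus_nonempty : (unit_circle `\` J) !=set0.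
Proof.
apply: contrapT => /set0P/negP; rewrite negbK => /eqP; rewrite setD_eq0 => CJ.
by apply: J_proper; rewrite eqEsubset; split.
Qed.

Lemma dist_le z w : (unit_circle `\` J) w ->
  dist z (unit_circle `\` J) <= normc (z - w).
Proof.
move=> Jw; apply: ge_inf; last by exists w.
by exists 0 => _ [y _ <-]; exact: normc_ge0.
Qed.

Lemma dist_ge z (c : R) : (forall w, (unit_circle `\` J) w -> c <= normc (z - w)) ->
  c <= dist z (unit_circle `\` J).
Proof.
move=> cJ; apply: lb_le_inf; last by move=> _ [w Jw <-]; exact: cJ.
by have [w Jw] := circle_minus_nonempty; exists (normc (z - w)), w.
Qed.

Lemma dist_lipschitz z w : dist z (unit_circle `\` J) <=
  dist w (unit_circle `\` J) + normc (z - w).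
Proof.
rewrite -lerBlDr; apply: dist_ge => y Jy; rewrite lerBlDr addrC.
exact: le_trans (dist_le z Jy) (ler_normc_dist _ _ _).
Qed.

Lemma disc_J_le1 z : (unit_disc `|` J) z -> normc z <= 1.
Proof. by case=> [/unit_discP/ltW//|/J_sub/unit_circleP->]. Qed.

(** Points of the circle outside J are at distance 0 from the circle minus J, so
membership in the disc or J can be weakened to membership in the closed disc;
in this form Delta_m is visibly closed. *)
Lemma DeltaP m z : (0 < m)%N ->
  Delta J m z <-> normc z <= 1 /\ m%:R^-1 <= dist z (unit_circle `\` J).
Proof.
move=> m0; split=> [[zA zm]|[+ zm]]; first by split=> //; exact: disc_J_le1.
rewrite le_eqVlt => /predU1P[z1|/unit_discP]; last by split=> //; left.
split=> //; right; apply: contrapT => Jz; move: zm.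
rewrite leNgt => /negP; apply.
apply: (@le_lt_trans _ _ 0); last by rewrite invr_gt0 ltr0n.
apply: (le_trans (@dist_le z z _)); last by rewrite subrr normc0.
by split=> //; apply/unit_circleP.
Qed.

Lemma compact_Delta m : (0 < m)%N -> compact (Delta J m).
Proof.
move=> m0.
have -> : Delta J m = [set z | normc z <= 1] `&`
    (fun z => dist z (unit_circle `\` J)) @^-1` [set x | m%:R^-1 <= x].
  by rewrite eqEsubset; split=> z /(DeltaP z m0).
apply: compact_closedI; first exact: compact_normc_le1.
apply: closed_comp; last exact: closed_ge.
by move=> z _; apply: lipschitz_normc_continuous; exact: dist_lipschitz.
Qed.

Lemma Delta0 m : (0 < m)%N -> Delta J m 0.
Proof.
move=> m0; split; first by left; apply/unit_discP; rewrite normc0.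
apply: dist_ge => w [/unit_circleP w1 _].
by rewrite sub0r normcN w1 invf_le1 ?ler1n// ltr0n.
Qed.

(** The seminorm is a supremum of reals, so this needs h to be bounded on
Delta_m: that is where compactness enters. *)
Lemma seminorm_ub m h z : (0 < m)%N -> {within unit_disc `|` J, continuous h} ->
  Delta J m z -> normc (h z) <= seminorm J m h.
Proof.
move=> m0 /within_continuous_normcP hC zm.
apply: ub_le_sup; last by exists z.
(* The bound is sought as the inverse of a small parameter. *)
have [|d d0 dP] := @compact_uniform_pos (Delta J m)
    (fun e y => normc (h y) <= e^-1) (compact_Delta m0).
  move=> y [yA _]; have [d d0 dP] := hC y yA 1 ltr01.
  exists (Num.min d (normc (h y) + 1)^-1).
    by rewrite lt_min d0 invr_gt0 ltr_wpDl// normc_ge0.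
  move=> e u /andP[e0]; rewrite lt_min => /andP[_ eh] [uA _].
  rewrite lt_min => /andP[/(dP u uA) hu _].
  have he : normc (h y) + 1 <= e^-1.
    by rewrite -[leLHS]invrK lef_pV2 ?posrE ?invr_gt0 ?ltr_wpDl ?normc_ge0// ltW.
  have := ler_normcD (h u - h y) (h y); rewrite subrK; lra.
have d20 : 0 < d / 2 < d by rewrite divr_gt0//= ltr_pdivrMr// ltr_pMr// ltrDl.
by exists (d / 2)^-1 => _ [y ym <-]; exact: dP.
Qed.

Lemma seminorm_le m h (c : R) : (0 < m)%N ->
  (forall z, Delta J m z -> normc (h z) <= c) -> seminorm J m h <= c.
Proof.
move=> m0 hc; apply: ge_sup; last by move=> _ [z zm <-]; exact: hc.
by exists (normc (h 0)), 0 => //; exact: Delta0.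
Qed.

End Seminorms.
End DiscSeminorms.

(** * Rotations of the unit circle *)

Section Rotations.
Context {R : realType}.
Implicit Types (z c : R[i]) (h t : R).

Lemma normcX_le1 z n : normc z <= 1 -> normc (z ^+ n) <= 1.
Proof. by move=> z1; rewrite normcX exprn_ile1// normc_ge0. Qed.

Lemma normc_sum (n : nat) (F : nat -> R[i]) (G : nat -> R) :
  (forall i, (i < n)%N -> normc (F i) <= G i) ->
  normc (\sum_(i < n) F i) <= \sum_(i < n) G i.
Proof.
elim: n => [|n IH] FG; first by rewrite !big_ord0 normc0.
rewrite !big_ord_recr /=; apply: le_trans (ler_normcD _ _) _.
by apply: lerD; [apply: IH => i ?; apply: FG; exact: ltnW|exact: FG].
Qed.

Lemma eitheta0 : eitheta 0 = 1 :> R[i].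
Proof. by rewrite /eitheta cos0 sin0. Qed.

Lemma abs_sin_le (x : R) : `|sin x| <= `|x|.
Proof.
wlog x0 : x / 0 < x => [H|].
  have [x0|x0|->] := ltgtP x 0; last by rewrite sin0.
    by rewrite -normrN -sinN -(normrN x); apply: H; rewrite oppr_gt0.
  exact: H.
have [c _] := @MVT _ sin cos 0 x x0 (fun t _ => is_derive_sin t)
  (continuous_subspaceT (@continuous_sin R)).
rewrite sin0 !subr0 => ->; rewrite normrM ler_piMl//.
exact: cos_max.
Qed.

Lemma normc_eitheta h : normc (eitheta h) = 1.
Proof. by rewrite /= cos2Dsin2 sqrtr1. Qed.

Lemma eithetaD (s t : R) : eitheta (s + t) = eitheta s * eitheta t.
Proof.
apply/eqP; rewrite eq_complex /= cosD sinD eqxx /=.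
by rewrite addrC; apply/eqP; ring.
Qed.

Lemma eithetaX h n : eitheta h ^+ n = eitheta (h *+ n).
Proof.
elim: n => [|n IH]; first by rewrite expr0 mulr0n eitheta0.
by rewrite exprS IH mulrS eithetaD.
Qed.

(** A chord is shorter than its arc: its length is 2 |sin (h / 2)|. *)
Lemma normc_eitheta_sub1 h : normc (eitheta h - 1) <= `|h|.
Proof.
have -> : normc (eitheta h - 1) = `|2 * sin (h / 2)|.
  rewrite /= subr0 -sqrtr_sqr; congr (Num.sqrt _).
  have hE : h = (h / 2) *+ 2 by rewrite -mulr_natr divfK.
  have := cos2Dsin2 h; have := cos2Dsin2 (h / 2).
  have -> : cos h = cos (h / 2) ^+ 2 *+ 2 - 1 by rewrite {1}hE cos_mulr2n.
  set c := cos _; set s := sin _; set t := sin _ => E1 E2.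
  have -> : t ^+ 2 = 1 - (c ^+ 2 *+ 2 - 1) ^+ 2 by lra.
  have -> : c ^+ 2 = 1 - s ^+ 2 by lra.
  ring.
rewrite normrM (ger0_norm (ler0n _ 2)).
have := abs_sin_le (h / 2); rewrite normrM (@ger0_norm _ 2^-1)//; lra.
Qed.

Lemma normc_eithetaX_sub1 h n : normc (eitheta h ^+ n - 1) <= n%:R * `|h|.
Proof.
rewrite subrX1 normcM mulrC; apply: ler_pM; rewrite ?normc_ge0//.
  apply: (le_trans (@normc_sum n (fun i => eitheta h ^+ i) (fun=> 1) _)).
    by move=> i _; apply: normcX_le1; rewrite normc_eitheta.
  by rewrite sumr_const card_ord.
exact: normc_eitheta_sub1.
Qed.

Lemma quarter_turn4 (t : R) : `|t| = pi / 2 -> eitheta t ^+ 4 = 1.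
Proof.
have i4 (i : R[i]) : i ^+ 2 = -1 -> i ^+ 4 = 1.
  by rewrite -[4%N]/(2 * 2)%N exprM => ->; rewrite sqrrN expr1n.
move=> tE; apply: i4; rewrite eithetaX mulr2n eithetaD.
have [t0|t0] := ger0P t; rewrite ?(ger0_norm t0) ?(ltr0_norm t0) in tE.
  rewrite tE; apply/eqP; rewrite eq_complex /= cos_pihalf sin_pihalf.
  by apply/andP; split; apply/eqP; ring.
rewrite -[t]opprK tE; apply/eqP; rewrite eq_complex /= cosN sinN.
by rewrite cos_pihalf sin_pihalf; apply/andP; split; apply/eqP; ring.
Qed.

(** The two quarter turns move the real part of x + iy by -(x + y) and y - x, and
the larger of |x + y| and |x - y| is |x| + |y|, which is at least the norm. *)
Lemma quarter_turn_ReB c : normc c = 1 -> exists2 t : R, `|t| = pi / 2 &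
  1 <= `|complex.Re (c * (eitheta t - 1))|.
Proof.
move=> c1; have := ler_normc_ReIm c; rewrite c1.
case: c c1 => x y _ /= xy.
have pi0 : 0 < pi / 2 :> R by have /andP[] := @pihalf_02 R.
have [xy1|] := lerP 1 `|x + y|.
  exists (pi / 2); first by rewrite gtr0_norm.
  rewrite /= cos_pihalf sin_pihalf; apply: le_trans xy1 _.
  by rewrite -normrN le_eqVlt; apply/orP; left; apply/eqP; congr `|_|; ring.
rewrite ltr_norml => /andP[xy1 xy2].
exists (- (pi / 2)); first by rewrite normrN gtr0_norm.
rewrite /= cosN sinN cos_pihalf sin_pihalf.
have -> : x * (0 - 1) - y * (-1 - 0) = y - x by ring.
rewrite ler_normr; move: xy.
by case: (ger0P x) => x0; case: (ger0P y) => y0 xy; apply/orP;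
  [lra|right; lra|left; lra|lra].
Qed.
End Rotations.

(** * Dyadic sums of bounded complex sequences *)

Section DyadicSums.
Context {R : realType}.
Implicit Types (z w y : R[i]) (c d : nat -> R[i]).

Lemma cvg_ReIm (u : nat -> R[i]) (a b : R) :
  complex.Re (u n) @[n --> \oo] --> a -> complex.Im (u n) @[n --> \oo] --> b ->
  u @ \oo --> (a +i* b).
Proof.
move=> ua ub A /nbhs_normcP[e e0 eA].
have e20 : 0 < e / 2 by rewrite divr_gt0.
have na := ua _ (nbhsx_ballx a _ e20); have nb := ub _ (nbhsx_ballx b _ e20).
apply: (@filterS _ \oo _ ((fun n => ball a (e / 2) (complex.Re (u n))) `&`
    (fun n => ball b (e / 2) (complex.Im (u n))))); last exact: filterI.
move=> n [/= an bn]; apply: eA.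
apply: le_lt_trans (ler_normc_ReIm _) _.
have -> : complex.Re (u n - a +i* b) = complex.Re (u n) - a by case: (u n).
have -> : complex.Im (u n - a +i* b) = complex.Im (u n) - b by case: (u n).
by rewrite (splitr e); apply: ltrD; rewrite distrC.
Qed.

Definition dyadic c : nat -> R[i] := fun k => (2^-1 ^+ k)%:C * c k.
Definition dyadic_sum c : R[i] := limn (series (dyadic c)).

Lemma normc_dyadic c k : normc (dyadic c k) = 2^-1 ^+ k * normc (c k).
Proof. by rewrite normcM normc_real ger0_norm// exprn_ge0. Qed.

Lemma half_lt1 : `|2^-1 : R| < 1.
Proof. by rewrite gtr0_norm ?invr_gt0// invf_lt1 ?ltr0n// ltr1n. Qed.

(** Absolute convergence of the real and imaginary parts, by comparison with a
geometric series. *)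
Lemma is_cvg_dyadic c (C : R) : (forall k, normc (c k) <= C) ->
  cvgn (series (dyadic c)).
Proof.
move=> cC.
have H (L : R[i] -> R) : (forall z, `|L z| <= normc z) ->
    cvgn (series (fun k => L (dyadic c k))).
  move=> LN; apply: normed_cvg.
  apply: (@series_le_cvg _ _ (geometric C 2^-1)) => //=.
  - by move=> n; rewrite mulr_ge0// ?exprn_ge0//; apply: le_trans (cC n); exact: normc_ge0.
  - move=> n; apply: (le_trans (LN _)); rewrite normc_dyadic mulrC.
    by rewrite ler_wpM2r ?exprn_ge0.
  - exact: is_cvg_geometric_series half_lt1.
apply/cvg_ex; exists (limn (series (@complex.Re R \o dyadic c)) +i*
                      limn (series (@complex.Im R \o dyadic c))).
apply: cvg_ReIm.
  have -> : (fun n => complex.Re (series (dyadic c) n)) =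
            series (@complex.Re R \o dyadic c).
    apply/funext; elim => [|n IH]; first by rewrite /series /= !big_geq.
    by rewrite !seriesSr -IH /=; case: (series _ _) (dyadic c n) => [? ?] [].
  exact: (H _ ler_Re_normc).
have -> : (fun n => complex.Im (series (dyadic c) n)) =
          series (@complex.Im R \o dyadic c).
  apply/funext; elim => [|n IH]; first by rewrite /series /= !big_geq.
  by rewrite !seriesSr -IH /=; case: (series _ _) (dyadic c n) => [? ?] [].
exact: (H _ ler_Im_normc).
Qed.

Lemma dyadic_sumB c d (C D : R) :
  (forall k, normc (c k) <= C) -> (forall k, normc (d k) <= D) ->
  dyadic_sum (fun k => c k - d k) = dyadic_sum c - dyadic_sum d.
Proof.
move=> cC dD.
rewrite -(lim_seriesB (is_cvg_dyadic cC) (is_cvg_dyadic dD)).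
by congr (limn (series _)); apply/funext => k; rewrite /dyadic mulrBr.
Qed.

Lemma dyadic_sumZ a c (C : R) : (forall k, normc (c k) <= C) ->
  dyadic_sum (fun k => a * c k) = a * dyadic_sum c.
Proof.
move=> cC; apply: etrans (lim_seriesZ a (is_cvg_dyadic cC)).
by congr (limn (series _)); apply/funext => k; rewrite /dyadic mulrCA.
Qed.

Lemma dyadic_sum_finite c N : (forall k, (N <= k)%N -> c k = 0) ->
  dyadic_sum c = \sum_(k < N) dyadic c k.
Proof.
move=> cN; apply: lim_near_cst; first exact: norm_hausdorff.
exists N => // n /= Nn; rewrite /series /= -(big_mkord xpredT).
rewrite (big_cat_nat (n := N))//= [X in _ + X]big_nat.
rewrite [X in _ + X]big1 ?addr0// => k /andP[Nk _].
by rewrite /dyadic cN// mulr0.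
Qed.

Lemma dyadic_sum_tail c (C : R) N : (forall k, normc (c k) <= C) ->
  normc (dyadic_sum c - \sum_(k < N) dyadic c k) <= C * 2 * 2^-1 ^+ N.
Proof.
move=> cC.
have C0 : 0 <= C by apply: le_trans (cC 0%N); exact: normc_ge0.
have part n : normc (series (dyadic c) (n + N)%N - series (dyadic c) N) <=
    C * 2 * (2^-1 ^+ N - 2^-1 ^+ (n + N)).
  elim: n => [|n IH]; first by rewrite add0n !subrr normc0 mulr0.
  rewrite addSn seriesSr addrAC; apply: le_trans (ler_normcD _ _) _.
  have tn : normc (dyadic c (n + N)) <= 2^-1 ^+ (n + N) * C.
    by rewrite normc_dyadic ler_wpM2l ?exprn_ge0.
  apply: (le_trans (lerD IH tn)).
  rewrite exprS -subr_ge0 [X in 0 <= X](_ : _ = 0)//; lra.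
have -> : \sum_(k < N) dyadic c k = series (dyadic c) N by rewrite seriesEord.
apply/ler_addgt0Pr => e e0.
have /(is_cvg_dyadic cC) : nbhs (dyadic_sum c) [set y | normc (y - dyadic_sum c) < e].
  by apply/nbhs_normcP; exists e.
move=> [M _ MP].
have /ltW H1 : normc (dyadic_sum c - series (dyadic c) (M + N)%N) < e.
  by rewrite normc_distC; exact: MP (leq_addr _ _).
have H2 := part M.
apply: le_trans (ler_normc_dist _ (series (dyadic c) (M + N)%N) _) _.
apply: (le_trans (lerD H1 H2)); rewrite [leRHS]addrC lerD2l.
by rewrite ler_wpM2l ?mulr_ge0// gerBl exprn_ge0.
Qed.

Lemma continuous_sum_ord (F : nat -> R[i] -> R[i]) N :
  (forall k, continuous (F k)) -> continuous (fun y => \sum_(k < N) F k y).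
Proof.
move=> FC; elim: N => [|N IH].
  rewrite (_ : (fun y => _) = cst 0); first exact: cst_continuous.
  by apply/funext => y; rewrite big_ord0.
rewrite (_ : (fun y => _) = (fun y => \sum_(k < N) F k y + F N y)).
  by move=> y; exact: (cvgD (IH y) (FC N y)).
by apply/funext => y; rewrite big_ord_recr.
Qed.

Lemma continuous_exprn n : continuous (fun y : R[i] => y ^+ n).
Proof.
elim: n => [|n IH].
  rewrite (_ : (fun y => _) = cst 1); first exact: cst_continuous.
  by apply/funext => y; rewrite expr0.
rewrite (_ : (fun y => _) = (fun y => y * y ^+ n)).
  move=> y; have yC : {for y, continuous (fun y : R[i] => y)} by exact: cvg_id.
  exact: (cvgM yC (IH y)).
by apply/funext => y; rewrite exprS.
Qed.

(** The Weierstrass test: the tails are bounded by C 2^(1-N) uniformly on the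
closed disc, and the partial sums are continuous. *)
Lemma dyadic_sum_continuous (q : nat -> R[i] -> R[i]) (C : R) :
  (forall k, continuous (q k)) ->
  (forall k y, normc y <= 1 -> normc (q k y) <= C) ->
  forall z, normc z <= 1 -> forall e : R, 0 < e -> exists2 d : R, 0 < d &
    forall y, normc y <= 1 -> normc (y - z) < d ->
      normc (dyadic_sum (q^~ y) - dyadic_sum (q^~ z)) < e.
Proof.
move=> qC qb z z1 e e0.
have C0 : 0 <= C by apply: le_trans (qb 0%N 0 _); rewrite ?normc_ge0 ?normc0.
have [N hN] : exists N, C * 2 * 2^-1 ^+ N < e / 3.
  have e30 : 0 < e / 3 by rewrite divr_gt0.
  have := @cvg_geometric _ (C * 2) 2^-1 half_lt1.
  move=> /(_ _ (nbhsx_ballx 0 _ e30)) [N _ NP]; exists N.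
  have := NP N (leqnn N); rewrite /ball /= sub0r normrN => /(le_lt_trans _); apply.
  exact: ler_norm.
have sC : continuous (fun y => \sum_(k < N) dyadic (q^~ y) k).
  apply: (@continuous_sum_ord (fun k y => dyadic (q^~ y) k)) => k y.
  exact: (cvgM (cvg_cst _) (qC k y)).
have /sC /nbhs_normcP[d d0 dP] :
   nbhs (\sum_(k < N) dyadic (q^~ z) k)
     [set y | normc (y - \sum_(k < N) dyadic (q^~ z) k) < e / 3].
  by apply/nbhs_normcP; exists (e / 3) => //; rewrite divr_gt0.
exists d => // y y1 /dP /= Hy.
have ty := @dyadic_sum_tail (q^~ y) C N (fun k => qb k y y1).
have tz := @dyadic_sum_tail (q^~ z) C N (fun k => qb k z z1).
apply: le_lt_trans (ler_normc_dist _ (\sum_(k < N) dyadic (q^~ y) k) _) _.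
apply: (le_lt_trans (lerD ty (ler_normc_dist _ (\sum_(k < N) dyadic (q^~ z) k) _))).
rewrite (normc_distC (\sum_(k < N) _) (dyadic_sum _)); lra.
Qed.
End DyadicSums.

(** * The lacunary function on the closed disc *)

Section Lacunary.
Context {R : realType}.
Implicit Types (z w y a : R[i]) (h : R).

(** The ratio 8 is divisible by 4, so that a quarter turn of one term fixes all
later ones, and is large enough for the terms before a given one to have a
smaller total slope than that term. *)
Definition lacunary z : R[i] := dyadic_sum (fun k => z ^+ (8 ^ k)).

Lemma lacunary_continuous z : normc z <= 1 ->
  forall e : R, 0 < e -> exists2 d : R, 0 < d &
    forall y, normc y <= 1 -> normc (y - z) < d ->
      normc (lacunary y - lacunary z) < e.
Proof.
move=> z1 e e0.
apply: (@dyadic_sum_continuous _ (fun k y => y ^+ (8 ^ k)) 1) => //.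
  by move=> k; exact: continuous_exprn.
by move=> k y y1; exact: normcX_le1.
Qed.

Lemma lacunary_bounded z : normc z <= 1 -> normc (lacunary z) <= 2.
Proof.
move=> z1; have := @dyadic_sum_tail _ (fun k => z ^+ (8 ^ k)) 1 0.
rewrite big_ord0 subr0 expr0 mulr1 mul1r; apply => k; exact: normcX_le1.
Qed.

(** Factoring y - z out of the difference of the values at y and z leaves the
series sum_k 2^-k (sum_i y^(8^k - 1 - i) z^i), whose inner sums are at most
1 / (1 - |z|) for y in the closed disc.  It is therefore continuous in y, and
its value at y = z is the derivative. *)
Lemma lacunary_derivable z : normc z < 1 -> derivable lacunary z 1.
Proof.
move=> z1.
pose q k y := \sum_(i < 8 ^ k) y ^+ ((8 ^ k).-1 - i) * z ^+ i.
pose C := (1 - normc z)^-1.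
have z10 : 0 < 1 - normc z by rewrite subr_gt0.
have qb k y : normc y <= 1 -> normc (q k y) <= C.
  move=> y1; pose F i := y ^+ ((8 ^ k).-1 - i) * z ^+ i.
  apply: (@le_trans _ _ (\sum_(i < 8 ^ k) normc z ^+ i)).
    apply: (@normc_sum _ _ F) => i _; rewrite /F normcM (normcX z).
    by rewrite ler_piMl ?exprn_ge0 ?normc_ge0// normcX_le1.
  rewrite /C -[leRHS]mul1r ler_pdivlMr// mulrC -opprB mulNr -subrX1 opprB.
  by rewrite gerBl exprn_ge0 ?normc_ge0.
have qC k : continuous (q k).
  apply: (@continuous_sum_ord _ (fun i y => y ^+ ((8 ^ k).-1 - i) * z ^+ i)).
  move=> i y; exact: (cvgM (@continuous_exprn _ ((8 ^ k).-1 - i) y) (cvg_cst _)).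
have lacB y : normc y <= 1 ->
    lacunary y - lacunary z = (y - z) * dyadic_sum (q^~ y).
  move=> y1; rewrite -(@dyadic_sumZ _ _ _ C); last by move=> k; exact: qb.
  rewrite -(@dyadic_sumB _ _ _ 1 1); first last.
  - by move=> k; apply: normcX_le1; exact: ltW.
  - by move=> k; exact: normcX_le1.
  by congr dyadic_sum; apply/funext => k; rewrite subrXX.
apply/derivable_normcP; exists (dyadic_sum (q^~ z)) => e e0.
have [d d0 dP] := dyadic_sum_continuous qC qb (ltW z1) e0.
exists (Num.min d (1 - normc z)); first by rewrite lt_min d0.
move=> y; rewrite lt_min => /andP[yd yz].
have y1 : normc y <= 1.
  by have := ler_normcD (y - z) z; rewrite subrK; lra.
rewrite lacB// -mulrBr normcM mulrC ler_wpM2r ?normc_ge0//.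
by apply/ltW/dP.
Qed.

End Lacunary.

(** * Steepness of the lacunary function on the circle *)

Section Steepness.
Context {R : realType}.
Implicit Types (z w y a c : R[i]) (h : R).

Lemma sum_geometric4 k : \sum_(j < k) 4 ^+ j <= 4 ^+ k / 3 :> R.
Proof.
elim: k => [|k IH]; first by rewrite big_ord0 divr_ge0// exprn_ge0.
by rewrite big_ord_recr /= exprS; lra.
Qed.

(** With h a quarter turn divided by 8^k, the terms of index greater than k do not
change, the term of index k contributes at least 2^-k, and the terms before it
contribute at most the sum of 2^-j 8^j |h| = 4^j |h| over j < k. *)
Lemma lacunary_oscillation a z k : normc a = 1 -> normc z = 1 ->
  exists2 h, `|h| = pi / 2 / 8 ^+ k &
    2^-1 ^+ k - 4 ^+ k / 3 * `|h| <=
    `|complex.Re (a * (lacunary (z * eitheta h) - lacunary z))|.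
Proof.
move=> a1 z1.
have [t tE tP] : exists2 t : R, `|t| = pi / 2 &
    1 <= `|complex.Re (a * z ^+ (8 ^ k) * (eitheta t - 1))|.
  by apply: quarter_turn_ReB; rewrite normcM a1 normcX z1 expr1n mul1r.
have e0 : 0 < 8 ^+ k :> R by rewrite exprn_gt0.
pose h : R := t / 8 ^+ k.
have hE n : h *+ (8 ^ k * n) = t *+ n.
  rewrite mulrnA; congr (_ *+ n).
  by rewrite -mulr_natr natrX /h divfK// gt_eqF.
exists h; first by rewrite normrM tE normfV (gtr0_norm e0).
pose D j := z ^+ (8 ^ j) * (eitheta h ^+ (8 ^ j) - 1).
have DE : lacunary (z * eitheta h) - lacunary z = dyadic_sum D.
  rewrite -(@dyadic_sumB _ _ _ 1 1); first last.
  - by move=> j; apply: normcX_le1; rewrite z1.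
  - by move=> j; apply: normcX_le1; rewrite normcM z1 normc_eitheta mul1r.
  by congr dyadic_sum; apply/funext => j; rewrite exprMn /D mulrBr mulr1.
(* 8^j is a multiple of 4 * 8^k, so the rotation raised to it is a full turn. *)
have D0 j : (k < j)%N -> D j = 0.
  move=> kj; rewrite /D eithetaX.
  have -> : (8 ^ j = 8 ^ k * (4 * (2 * 8 ^ (j - k.+1))))%N.
    by rewrite -{1}(subnK kj) addnS expnS expnD; ring.
  by rewrite hE mulrnA -eithetaX -eithetaX quarter_turn4// expr1n subrr mulr0.
have Dk : D k = z ^+ (8 ^ k) * (eitheta t - 1).
  by rewrite /D eithetaX -[X in h *+ X]muln1 hE mulr1n.
rewrite DE (@dyadic_sum_finite _ D k.+1)// big_ord_recr /=.
set low := \sum_(j < k) _.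
have lowB : normc low <= 4 ^+ k / 3 * `|h|.
  apply: (@le_trans _ _ (\sum_(j < k) 4 ^+ j * `|h|)).
    apply: (@normc_sum _ _ (dyadic D) (fun j => 4 ^+ j * `|h|)) => j _.
    rewrite normc_dyadic normcM normcX z1 expr1n mul1r.
    apply: (@le_trans _ _ (2^-1 ^+ j * ((8 ^ j)%:R * `|h|))).
      by rewrite ler_wpM2l ?exprn_ge0// normc_eithetaX_sub1.
    rewrite mulrA natrX -exprMn.
    by rewrite (_ : 2^-1 * 8%:R = 4 :> R)//; field.
  by rewrite -mulr_suml ler_wpM2r// sum_geometric4.
have mainE : complex.Re (a * dyadic D k) = 2^-1 ^+ k *
    complex.Re (a * z ^+ (8 ^ k) * (eitheta t - 1)).
  by rewrite /dyadic Dk mulrCA ReZ mulrA.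
rewrite mulrDr ReD mainE.
have := ler_Re_normc (a * low); rewrite normcM a1 mul1r => ReL.
have mB : 2^-1 ^+ k <=
    `|2^-1 ^+ k * complex.Re (a * z ^+ (8 ^ k) * (eitheta t - 1))|.
  by rewrite normrM ger0_norm ?exprn_ge0// ler_peMr ?exprn_ge0.
have := lerB_normD (2^-1 ^+ k * complex.Re (a * z ^+ (8 ^ k) * (eitheta t - 1)))
  (complex.Re (a * low)).
rewrite [_ + complex.Re (a * low)]addrC; apply: le_trans.
by apply: lerB => //; exact: le_trans lowB.
Qed.

Lemma lacunary_steep a z (M d : R) : normc a = 1 -> normc z = 1 -> 0 < d ->
  exists2 h, 0 < `|h| < d &
    M * `|h| <= `|complex.Re (a * (lacunary (z * eitheta h) - lacunary z))|.
Proof.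
move=> a1 z1 d0.
(* k makes 2/8^k < d and 6 M < 4^k, already with 2^k in place of 8^k and 4^k. *)
pose k := maxn (Num.Def.archi_bound (2 / d)) (Num.Def.archi_bound (6 * M)).
have [h hE hP] := lacunary_oscillation k a1 z1.
have /andP[pi0 pi2] := @pihalf_02 R.
pose p : R := 2 ^+ k.
have p1 : 1 <= p by rewrite exprn_ege1// ler1n.
have p0 : 0 < p by exact: lt_le_trans p1.
have pd : 2 / d < p by apply: upper_nthrootP; exact: leq_maxl.
have pM : 6 * M < p by apply: upper_nthrootP; exact: leq_maxr.
have E4 : 4 ^+ k = p ^+ 2 :> R by rewrite exprAC; congr (_ ^+ _); ring.
have E8 : 8 ^+ k = p ^+ 3 :> R by rewrite exprAC; congr (_ ^+ _); ring.
have h0 : 0 < `|h| by rewrite hE divr_gt0// exprn_gt0.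
have hp : `|h| * p ^+ 3 <= 2.
  by rewrite hE E8 divfK ?gt_eqF ?exprn_gt0// ltW.
exists h.
  rewrite h0 /=; move: pd; rewrite ltr_pdivrMr// => pd.
  have p23 : p <= p ^+ 3 by rewrite -[leLHS]expr1 ler_weXn2l.
  have : `|h| * p <= 2 by apply: le_trans hp; rewrite ler_wpM2l.
  by move=> hp1; rewrite -(ltr_pM2l p0) mulrC (le_lt_trans hp1).
apply: le_trans hP; rewrite E4 exprVn -/p.
have hp2 : `|h| * p ^+ 2 / 2 <= p^-1.
  rewrite ler_pdivrMr// -(ler_pM2r p0) [leRHS]mulrAC mulVf ?gt_eqF// mul1r.
  by rewrite -mulrA -exprSr.
have : M * `|h| <= p ^+ 2 / 6 * `|h|.
  rewrite ler_wpM2r// ler_pdivlMr// mulrC; apply: le_trans (ltW pM) _.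
  by rewrite -[leLHS]expr1 ler_weXn2l.
lra.
Qed.
End Steepness.

(** * Perturbed dilations *)

Section Perturbation.
Context {R : realType}.
Implicit Types (z w y a c : R[i]) (h e s : R) (J : set R[i]) (f g : R[i] -> R[i]).

Lemma derivable_lipschitz f z : derivable f z 1 ->
  exists2 M : R, 0 <= M & exists2 d : R, 0 < d &
    forall y, normc (y - z) < d -> normc (f y - f z) <= M * normc (y - z).
Proof.
move=> /derivable_normcP[L /(_ 1 ltr01)[d d0 dP]].
exists (1 + normc L); first by rewrite addr_ge0// normc_ge0.
exists d => // y /dP H.
have := ler_normcD (f y - f z - (y - z) * L) ((y - z) * L).
rewrite subrK normcM; lra.
Qed.

Lemma derivable_dilate f s z : derivable f (s%:C * z) 1 ->
  derivable (fun y => f (s%:C * y)) z 1.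
Proof.
move=> /derivable_normcP[L fL]; apply/derivable_normcP; exists (s%:C * L) => e e0.
have s1 : 0 < 1 + `|s| by rewrite ltr_pwDl.
have [d d0 dP] := fL (e / (1 + `|s|)) ltac:(by rewrite divr_gt0).
exists (d / (1 + `|s|)); first by rewrite divr_gt0.
move=> y; rewrite ltr_pdivlMr// => yz.
have syz : normc (s%:C * y - s%:C * z) <= normc (y - z) * (1 + `|s|).
  rewrite -mulrBr normcM normc_real mulrC.
  by rewrite ler_wpM2l ?normc_ge0// lerDr.
rewrite mulrA [_ * s%:C]mulrC mulrBr.
apply: (le_trans (dP _ (le_lt_trans syz yz))).
by rewrite mulrAC ler_pdivrMr// -mulrA ler_wpM2l// ltW.
Qed.

(** A single parameter controls both the dilation and the size of the lacunary
term, so that the approximants form a family tending to f as s tends to 0. *)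
Definition perturb f s : R[i] -> R[i] :=
  fun z => f ((1 - s)%:C * z) + s%:C * lacunary z.

Lemma normc_shrink_lt1 s z : 0 < s < 1 -> normc z <= 1 ->
  normc ((1 - s)%:C * z) < 1.
Proof.
move=> /andP[s0 s1] z1; rewrite normcM normc_real ger0_norm ?subr_ge0 ?ltW//.
apply: (@le_lt_trans _ _ (1 - s)); last by rewrite ltrBlDr ltrDl.
by rewrite ler_piMr// subr_ge0 ltW.
Qed.

Section Perturb.
Variables (J : set R[i]) (f : R[i] -> R[i]).
Hypothesis J_sub : J `<=` unit_circle.
Hypothesis fJ : in_ADJ J f.

Lemma shrink_derivable s z : 0 < s < 1 -> normc z <= 1 ->
  derivable (fun y => f ((1 - s)%:C * y)) z 1.
Proof.
move=> s01 z1; apply: derivable_dilate; case: fJ => + _ _; apply.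
by apply/unit_discP; exact: normc_shrink_lt1.
Qed.

Lemma perturb_continuous s z : 0 < s < 1 -> normc z <= 1 ->
  forall e, 0 < e -> exists2 d : R, 0 < d & forall y, normc y <= 1 ->
    normc (y - z) < d -> normc (perturb f s y - perturb f s z) < e.
Proof.
move=> s01 z1 e e0.
have e20 : 0 < e / 2 by rewrite divr_gt0.
have [M M0 [d1 d10 fd1]] := derivable_lipschitz (shrink_derivable s01 z1).
have [d2 d20 wd2] := lacunary_continuous z1 e20.
have M1 : 0 < M + 1 by rewrite ltr_wpDl.
exists (Num.min (Num.min d1 d2) (e / 2 / (M + 1))).
  by rewrite !lt_min d10 d20 divr_gt0.
move=> y y1; rewrite !lt_min -andbA => /and3P[yd1 yd2].
rewrite ltr_pdivlMr// => yM.
have -> : perturb f s y - perturb f s z = (f ((1 - s)%:C * y) - f ((1 - s)%:C * z))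
    + s%:C * (lacunary y - lacunary z).
  by rewrite /perturb opprD addrACA -mulrBr.
apply: le_lt_trans (ler_normcD _ _) _; rewrite (splitr e) ltrD//.
  apply: (le_lt_trans (fd1 _ yd1)); apply: le_lt_trans yM.
  by rewrite mulrC ler_wpM2l ?normc_ge0// lerDl.
apply: le_lt_trans (wd2 _ y1 yd2); case/andP: s01 => s0 s1.
by rewrite normcM normc_real ler_piMl ?normc_ge0// gtr0_norm// ltW.
Qed.

(** The perturbed dilate is cut off to 0 outside the disc and J, as the encoding
of A(D,J) by total functions requires. *)
Lemma perturb_in_ADJ s : 0 < s < 1 ->
  in_ADJ J (patch (fun=> 0) (unit_disc `|` J) (perturb f s)).
Proof.
move=> s01; split.
- move=> z /unit_discP z1; have z1' := ltW z1.
  apply: (@near_eq_derivable _ _ _ (perturb f s)).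
    apply/nbhs_normcP; exists (1 - normc z); first by rewrite subr_gt0.
    move=> y yz; rewrite /= patchE mem_set//; left; apply/unit_discP.
    by have := ler_normcD (y - z) z; rewrite subrK; lra.
  apply: derivableD; first exact: shrink_derivable.
  exact: (@derivableZ _ _ _ lacunary s%:C z 1 (lacunary_derivable z1)).
- apply/within_continuous_normcP => z zA e e0.
  have z1 := disc_J_le1 J_sub zA.
  have [d d0 dP] := perturb_continuous s01 z1 e0.
  exists d => // y yA yz; rewrite !patchE !mem_set//; apply: dP => //.
  exact: (disc_J_le1 J_sub).
- by move=> z zA; rewrite patchE memNset.
Qed.

(** The slack s lets the inequality survive small changes of g, which is what
makes [steep_set] open.  The bound 1/(2n) on the rotation keeps the rotated
point in Delta_(2n) when z lies in Delta_n ([Delta_rotate]). *)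
Definition steep_at (g : R[i] -> R[i]) (n : nat) a z s :=
  exists2 h, 0 < `|h| < (2 * n)%:R^-1 &
    n%:R * `|h| + s <= `|complex.Re (a * (g (z * eitheta h) - g z))|.

(** At one point of the circle, the steepness of the lacunary function beats the
Lipschitz constant of the dilate.  The same rotation works at nearby points by
continuity, and compactness of the circle gives a common slack. *)
Lemma perturb_steep s (n : nat) a : (0 < n)%N -> 0 < s < 1 -> normc a = 1 ->
  exists2 e, 0 < e & forall z, normc z = 1 -> steep_at (perturb f s) n a z e.
Proof.
move=> n0 s01 a1; have /andP[s0 s1] := s01.
have [|d d0 dP] := @compact_uniform_pos R _
    (fun e z => steep_at (perturb f s) n a z e) compact_unit_circle.
  move=> z /= z1; have z1' : normc z <= 1 by rewrite z1.
  have [M M0 [d d0 fd]] := derivable_lipschitz (shrink_derivable s01 z1').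
  (* Slope n + 1 instead of n leaves |h| to be spent on the slack. *)
  have [|h hd hP] := @lacunary_steep R a z ((n.+1%:R + M) / s)
      (Num.min d (2 * n)%:R^-1) a1 z1.
    by rewrite lt_min d0 invr_gt0 ltr0n muln_gt0.
  move: hd; rewrite lt_min => /and3P[h0 hd hn].
  set x := z * eitheta h.
  have x1 : normc x = 1 by rewrite normcM z1 normc_eitheta mulr1.
  have xz : normc (x - z) <= `|h|.
    by rewrite /x -{2}[z]mulr1 -mulrBr normcM z1 mul1r normc_eitheta_sub1.
  have zP : n.+1%:R * `|h| <= `|complex.Re (a * (perturb f s x - perturb f s z))|.
    have -> : a * (perturb f s x - perturb f s z) =
        s%:C * (a * (lacunary x - lacunary z)) +
        a * (f ((1 - s)%:C * x) - f ((1 - s)%:C * z)).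
      rewrite /perturb opprD addrACA -mulrBr mulrDr [a * (s%:C * _)]mulrCA.
      exact: addrC.
    rewrite ReD ReZ.
    have : `|complex.Re (a * (f ((1 - s)%:C * x) - f ((1 - s)%:C * z)))| <= M * `|h|.
      apply: (le_trans (ler_Re_normc _)); rewrite normcM a1 mul1r.
      by apply: (le_trans (fd _ (le_lt_trans xz hd))); rewrite ler_wpM2l.
    have : (n.+1%:R + M) * `|h| <= `|s * complex.Re (a * (lacunary x - lacunary z))|.
      rewrite normrM gtr0_norm// -ler_pdivrMl// mulrA [s^-1 * _]mulrC.
      exact: hP.
    set u := s * _; set v := complex.Re _ => H1 H2.
    have := lerB_normD u v; rewrite mulrDl in H1; lra.
  have h40 : 0 < `|h| / 4 by rewrite divr_gt0.
  have [d1 d10 dP1] := perturb_continuous s01 z1' h40.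
  have x1' : normc x <= 1 by rewrite x1.
  have [d2 d20 dP2] := perturb_continuous s01 x1' h40.
  exists (Num.min (Num.min d1 d2) (`|h| / 4)); first by rewrite !lt_min d10 d20.
  move=> e y /andP[e0]; rewrite !lt_min => /andP[_ eh] y1 /andP[/andP[yd1 yd2] _].
  exists h; first by rewrite h0.
  have y1' : normc y <= 1 by rewrite y1.
  have yh1 : normc (y * eitheta h) <= 1 by rewrite normcM y1 normc_eitheta mulr1.
  have yhx : normc (y * eitheta h - x) < d2.
    by rewrite /x -mulrBl normcM normc_eitheta mulr1.
  have Hy := dP1 _ y1' yd1; have Hx := dP2 _ yh1 yhx.
  move: (perturb f s) zP Hy Hx => p zP Hy Hx.
  have : `|complex.Re (a * (p (y * eitheta h) - p x))| < `|h| / 4.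
    by apply: (le_lt_trans (ler_Re_normc _)); rewrite normcM a1 mul1r.
  have : `|complex.Re (a * (p z - p y))| < `|h| / 4.
    apply: (le_lt_trans (ler_Re_normc _)); rewrite normcM a1 mul1r normc_distC; exact: Hy.
  have -> : a * (p (y * eitheta h) - p y) = a * (p (y * eitheta h) - p x) +
     (a * (p x - p z) + a * (p z - p y)) by rewrite -!mulrDr !subrKA.
  move: zP; rewrite !ReD -natr1.
  set v := complex.Re (a * (p x - p z)); set u := complex.Re (a * (p z - p y)).
  set t := complex.Re _ => H1 H2 H3.
  have := lerB_normD v (t + u); have := ler_normD t u.
  rewrite addrCA; lra.
have d20 : 0 < d / 2 < d by rewrite divr_gt0//= ltr_pdivrMr// ltr_pMr// ltrDl.
exists (d / 2); first by case/andP: d20.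
by move=> z z1; exact: dP.
Qed.

End Perturb.
End Perturbation.

(** * Steep functions in the disc algebra *)

Section SteepSets.
Context {R : realType}.
Implicit Types (z w y a c : R[i]) (h e s : R).
Variable J : set R[i].
Hypothesis J_sub : J `<=` unit_circle.
Hypothesis J_proper : J <> unit_circle.
Implicit Types (f g : ADJ J).

Lemma ADJ_in f : in_ADJ J (ADJ_fun f).
Proof. exact: set_valP. Qed.

Lemma ADJ_continuous f : {within unit_disc `|` J, continuous (ADJ_fun f)}.
Proof. by case: (ADJ_in f). Qed.

Lemma ADJ_sub_continuous f g :
  {within unit_disc `|` J, continuous (ADJ_fun f \- ADJ_fun g)}.
Proof.
by apply: within_continuousB; exact: ADJ_continuous.
Qed.

Lemma open_seminorm_ball m f e : (0 < m)%N -> 0 < e ->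
  open (seminorm_ball m f e).
Proof.
move=> m0 e0; exists [set seminorm_ball m f e]; last by rewrite bigcup_set1.
move=> _ ->; apply: (@finI_from1 _ _ (@seminorm_balls R J) id).
by exists m, f, e.
Qed.

Lemma seminorm_ball_center m f e : (0 < m)%N -> 0 < e -> seminorm_ball m f e f.
Proof.
move=> m0 e0; apply: (le_lt_trans _ e0); apply: seminorm_le => // z _.
by rewrite /= subrr normc0.
Qed.

Lemma seminorm_ball_lt m f e g z : (0 < m)%N -> seminorm_ball m f e g ->
  Delta J m z -> normc (ADJ_fun g z - ADJ_fun f z) < e.
Proof.
move=> m0 + zm; apply: le_lt_trans.
exact: (seminorm_ub J_sub J_proper m0 (@ADJ_sub_continuous g f) zm).
Qed.

Lemma Delta_rotate n z h : (0 < n)%N -> normc z = 1 -> Delta J n z ->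
  `|h| < (2 * n)%:R^-1 -> Delta J (2 * n) (z * eitheta h).
Proof.
move=> n0 z1 /(DeltaP J_sub _ n0)[_ zd] hn.
apply/(DeltaP J_sub); rewrite ?muln_gt0//.
split; first by rewrite normcM z1 normc_eitheta mulr1.
have := dist_lipschitz J_sub J_proper z (z * eitheta h).
have : normc (z - z * eitheta h) <= `|h|.
  rewrite normc_distC -{2}[z]mulr1 -mulrBr normcM z1 mul1r.
  exact: normc_eitheta_sub1.
have nE : (2 * n)%:R^-1 = n%:R^-1 / 2 :> R by rewrite natrM invfM mulrC.
by move: hn; rewrite nE; lra.
Qed.

Definition steep_set a n : set (ADJ J) :=
  [set g | exists2 e, 0 < e & forall z, normc z = 1 -> Delta J n z ->
     steep_at (ADJ_fun g) n a z e].

(** Steepness at the points of Delta_n only involves the values on Delta_(2n), so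
a ball of the seminorm of index 2n around g, of radius a quarter of the slack,
stays inside. *)
Lemma open_steep_set a n : (0 < n)%N -> normc a = 1 -> open (steep_set a n).
Proof.
move=> n0 a1; rewrite openE => g [e e0 gP].
have n20 : (0 < 2 * n)%N by rewrite muln_gt0.
have e40 : 0 < e / 4 by rewrite divr_gt0.
rewrite /interior nbhsE; exists (seminorm_ball (2 * n) g (e / 4)).
  split; first exact: open_seminorm_ball.
  exact: seminorm_ball_center.
move=> g' gg'; exists (e / 2); first by rewrite divr_gt0.
move=> z z1 zn; have [h /andP[h0 hn] hP] := gP z z1 zn.
exists h; first by rewrite h0.
have z2 : Delta J (2 * n) z.
  by rewrite -[z]mulr1 -eitheta0; apply: Delta_rotate; rewrite // normr0 invr_gt0 ltr0n.
have x2 : Delta J (2 * n) (z * eitheta h) by exact: Delta_rotate.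
have := seminorm_ball_lt n20 gg' z2; have := seminorm_ball_lt n20 gg' x2.
set x := z * eitheta h in hP *.
move: (ADJ_fun g) (ADJ_fun g') hP => p q hP.
rewrite normc_distC => Hx Hz.
have Lx : `|complex.Re (a * (p x - q x))| < e / 4.
  by apply: (le_lt_trans (ler_Re_normc _)); rewrite normcM a1 mul1r.
have Lz : `|complex.Re (a * (q z - p z))| < e / 4.
  by apply: (le_lt_trans (ler_Re_normc _)); rewrite normcM a1 mul1r.
move: hP Lx Lz.
have -> : a * (p x - p z) = a * (q x - q z) + (a * (p x - q x) + a * (q z - p z)).
  by rewrite addrCA -!mulrDr !subrKA.
rewrite !ReD; set u := complex.Re _; set v := complex.Re _; set t := complex.Re _.
have := ler_normD u (v + t); have := ler_normD v t; lra.
Qed.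

(** Near a point of Delta_m, both y and (1 - s) y are close to that point and in
the domain of f, so continuity of f there suffices; compactness of Delta_m makes
s uniform. *)
Lemma perturb_near m f e : (0 < m)%N -> 0 < e ->
  \forall s \near 0^'+, forall z, Delta J m z ->
    normc (perturb (ADJ_fun f) s z - ADJ_fun f z) < e.
Proof.
move=> m0 e0; have e40 : 0 < e / 4 by rewrite divr_gt0.
have fC := (within_continuous_normcP _ _).1 (@ADJ_continuous f).
have [|d d0 dP] := @compact_uniform_pos R _ (fun s z =>
    normc (perturb (ADJ_fun f) s z - ADJ_fun f z) < e) (compact_Delta J_sub J_proper m0).
  move=> z [zA _]; have [d d0 dP] := fC z zA _ e40.
  exists (Num.min (Num.min 1 (d / 2)) (e / 4)); first by rewrite !lt_min ltr01 e40 divr_gt0.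
  move=> s y /andP[s0]; rewrite !lt_min => /andP[/andP[s1 sd] se] [yA _] /andP[/andP[_ yd] _].
  have s01 : 0 < s < 1 by rewrite s0.
  have y1 := disc_J_le1 J_sub yA.
  have rA : (unit_disc `|` J) ((1 - s)%:C * y).
    by left; apply/unit_discP; exact: normc_shrink_lt1.
  have ryz : normc ((1 - s)%:C * y - z) < d.
    have -> : (1 - s)%:C * y - z = (y - z) + (- s)%:C * y.
      rewrite (rmorphB (real_complex R)) (rmorphN (real_complex R)).
      by rewrite rmorph1 mulrBl mul1r mulNr addrAC.
    apply: le_lt_trans (ler_normcD _ _) _; rewrite (splitr d) ltr_leD//.
    rewrite normcM normc_real normrN gtr0_norm//; apply: le_trans (ltW sd).
    by rewrite ler_piMr// ltW.
  have yz : normc (y - z) < d by apply: lt_trans yd _; rewrite ltr_pdivrMr// ltr_pMr// ltrDl.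
  have := dP _ rA ryz; have := dP _ yA yz; rewrite [normc (_ - _ z)]normc_distC => H1 H2.
  have H3 : normc (s%:C * lacunary y) <= e / 2.
    rewrite normcM normc_real gtr0_norm//.
    have := lacunary_bounded y1; nra.
  rewrite /perturb addrAC; apply: le_lt_trans (ler_normcD _ _) _.
  have := ler_normc_dist (ADJ_fun f ((1 - s)%:C * y)) (ADJ_fun f z) (ADJ_fun f y).
  lra.
near=> s => z zm; apply: dP => //; apply/andP; split; near: s.
  exact: nbhs_right_gt.
exact: nbhs_right_lt.
Unshelve. all: by end_near. Qed.

(** A neighbourhood of f contains a finite intersection of seminorm balls that
need not be centred at f; by the triangle inequality each of them contains the
perturbed dilates for small s. *)
Lemma open_perturb_near (O : set (ADJ J)) f : open O -> O f ->
  \forall s \near 0^'+, forall g,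
    {in unit_disc `|` J, ADJ_fun g =1 perturb (ADJ_fun f) s} -> O g.
Proof.
move=> oO fO.
have [D' D'P OE] : exists2 D' : set (set (ADJ J)),
  D' `<=` finI_from (@seminorm_balls R J) id & \bigcup_(i in D') i = O by exact: oO.
move: fO; rewrite -OE => -[B D'B Bf].
have [E EP BE] := D'P _ D'B.
suff H : forall i : set (ADJ J), [set` E] i -> \forall s \near 0^'+, forall g,
    {in unit_disc `|` J, ADJ_fun g =1 perturb (ADJ_fun f) s} -> i g.
  have := @filter_bigI _ _ E _ _ (@at_right_proper_filter R 0) H.
  apply: filterS => s sE g gs; exists B => //.
  by rewrite -BE => i iE; exact: sE.
move=> i iE; have /set_mem[m [f0 [e [m0 e0 iB]]]] := EP _ iE.
have : i f by move: Bf; rewrite -BE; exact.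
rewrite iB => fi.
have d0 : 0 < (e - seminorm J m (ADJ_fun f \- ADJ_fun f0)) / 2 by rewrite divr_gt0// subr_gt0.
apply: filterS (perturb_near f m0 d0) => s sP g gs.
rewrite /seminorm_ball /=.
apply: (@le_lt_trans _ _ ((e + seminorm J m (ADJ_fun f \- ADJ_fun f0)) / 2)).
  apply: seminorm_le => // z zm; have [zA _] := zm.
  have := seminorm_ub J_sub J_proper m0 (@ADJ_sub_continuous f f0) zm.
  have := sP z zm; rewrite -gs ?mem_set//=.
  have := ler_normc_dist (ADJ_fun g z) (ADJ_fun f z) (ADJ_fun f0 z); lra.
by rewrite -(ltr_pM2r (ltr0n R 2)) divfK//; lra.
Qed.
End SteepSets.

(** * Non-differentiability and density *)

Section Density.
Context {R : realType}.
Implicit Types (J : set R[i]).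

Lemma normc_minus_i : normc (0 -i* 1 : R[i]) = 1.
Proof. by rewrite /= expr0n add0r sqrrN expr1n sqrtr1. Qed.

Lemma Re_minus_i (z : R[i]) : complex.Re ((0 -i* 1) * z) = complex.Im z.
Proof. by case: z => x y /=; rewrite mul0r mulN1r sub0r opprK. Qed.

Lemma derivable_lipschitz_real (u : R -> R) (t : R) : derivable u t 1 ->
  exists M : R, exists2 d : R, 0 < d &
    forall h, 0 < `|h| < d -> `|u (t + h) - u t| <= M * `|h|.
Proof.
move=> /cvg_ex[/= L uL]; exists (`|L| + 1).
have := uL _ (nbhsx_ballx L _ ltr01).
rewrite /= /dnbhs /within /= => /nbhs_ballP[d /= d0 dP].
exists d => // h /andP[h0 hd]; have h0' : h != 0 by rewrite -normr_gt0.
have := dP h; rewrite /ball /= sub0r normrN => /(_ hd h0').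
rewrite /GRing.scale /= mulr1 [h + t]addrC.
set q := h^-1 * _ => Lq.
have -> : u (t + h) - u t = q * h by rewrite /q mulrC mulVKf.
rewrite normrM ler_wpM2r//.
have := ler_normB L (L - q); rewrite subKr; lra.
Qed.

Lemma dist_gt0 J z : J `<=` unit_circle -> J <> unit_circle ->
  relatively_open unit_circle J -> J z -> 0 < dist z (unit_circle `\` J).
Proof.
move=> J_sub J_proper [U oU JU] Jz.
have Uz : U z by move: Jz; rewrite JU => -[].
have /nbhs_normcP[e e0 eU] : nbhs z U by exact: open_nbhs_nbhs.
apply: (lt_le_trans e0); apply: dist_ge => // w [Cw nJw].
rewrite leNgt; apply/negP => zw; apply: nJw; rewrite JU; split=> //.
by apply: eU; rewrite normc_distC.
Qed.

(** A derivative at a point of J would bound the difference quotients by some M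
for |h| < d; this contradicts steepness of order n as soon as n exceeds M, 1/d
and the inverse of the distance from the point to the circle minus J. *)
Lemma steep_nowhere_differentiable J (a : R[i]) (g : ADJ J) :
  J `<=` unit_circle -> J <> unit_circle -> relatively_open unit_circle J ->
  (forall n, (0 < n)%N -> steep_set a n g) ->
  nowhere_differentiable_on J (fun z => complex.Re (a * ADJ_fun g z)).
Proof.
move=> J_sub J_proper J_open gP t Jt /derivable_lipschitz_real[M [d d0 dM]].
have r0 := dist_gt0 J_sub J_proper J_open Jt.
set r := dist _ _ in r0.
pose n := (maxn (Num.Def.archi_bound `|M|) (maxn (Num.Def.archi_bound d^-1)
  (Num.Def.archi_bound r^-1))).+1.
have nb x : 0 <= x -> (Num.Def.archi_bound x <= n)%N -> x < n%:R.
  by move=> x0 xn; apply: (lt_le_trans (archi_boundP x0)); rewrite ler_nat.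
have nM : M < n%:R.
  apply: (le_lt_trans (ler_norm M)); apply: nb => //.
  by rewrite leqW// leq_maxl.
have nd : d^-1 < n%:R.
  by apply: nb; rewrite ?invr_ge0 ?ltW//; rewrite leqW// leq_max leq_maxl orbT.
have nr : r^-1 < n%:R.
  by apply: nb; rewrite ?invr_ge0 ?ltW//; rewrite leqW// leq_max leq_maxr orbT.
have zn : Delta J n (eitheta t).
  apply/(DeltaP J_sub) => //; split; first by rewrite normc_eitheta.
  by rewrite -[leRHS]invrK lef_pV2 ?posrE ?invr_gt0 ?ltr0n// ltW.
have [e e0 /(_ _ (normc_eitheta t) zn)[h /andP[h0 hn]]] := gP n isT.
apply/negP; rewrite -ltNge.
have hd : `|h| < d.
  apply: (lt_trans hn); rewrite natrM invfM.
  apply: (@lt_trans _ _ n%:R^-1).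
    by rewrite gtr_pMl ?invr_gt0 ?ltr0n// invf_lt1 ?ltr0n// ltr1n.
  by rewrite -[ltRHS]invrK ltf_pV2 ?posrE ?invr_gt0 ?ltr0n.
have := dM h; rewrite h0 hd => /(_ isT) /=.
rewrite eithetaD mulrBr ReD ReN => /le_lt_trans; apply.
by rewrite -[ltLHS]addr0; apply: ler_ltD => //; rewrite ler_wpM2r// ltW.
Qed.

(** One perturbed dilate of f lies in all the steep sets simultaneously. *)
Lemma dense_steep J : J `<=` unit_circle -> J <> unit_circle ->
  dense (\bigcap_i (@steep_set R J 1 i.+1 `&` steep_set (0 -i* 1) i.+1)).
Proof.
move=> J_sub J_proper O [f Of] oO.
have [s [s01 sO]] : exists s : R, 0 < s < 1 /\ forall g,
    {in unit_disc `|` J, ADJ_fun g =1 perturb (ADJ_fun f) s} -> O g.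
  have Of' := open_perturb_near J_sub J_proper oO Of.
  have s01 : \forall s \near (0 : R)^'+, 0 < s < 1.
    by near=> s; apply/andP; split; near: s; [exact: nbhs_right_gt|exact: nbhs_right_lt].
  by have [s []] := @filter_ex _ _ (at_right_proper_filter (0 : R)) _ (filterI s01 Of'); exists s.
pose g : ADJ J := exist (fun x => x \in in_ADJ J) _ (mem_set (perturb_in_ADJ J_sub (ADJ_in f) s01)).
have gE : {in unit_disc `|` J, ADJ_fun g =1 perturb (ADJ_fun f) s}.
  by move=> z zA; rewrite /ADJ_fun /= patchE zA.
exists g; split; first exact: sO.
have steep (a : R[i]) (i : nat) : normc a = 1 -> steep_set a i.+1 g.
  move=> a1; have [e e0 eP] := perturb_steep (ADJ_in f) (ltn0Sn i) s01 a1.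
  exists e => // z z1 zn; have [h /andP[h0 hn] hP] := eP z z1.
  exists h; first by rewrite h0.
  have xn := Delta_rotate J_sub J_proper (ltn0Sn i) z1 zn hn.
  rewrite !gE// mem_set//; [by case: zn|by case: xn].
by move=> i _; split; apply: steep; rewrite ?normc1// normc_minus_i.
Unshelve. all: by end_near. Qed.
End Density.

Theorem theorem6p1 (R : realType) (J : set R[i])
    (J_sub : J `<=` unit_circle) (J_proper : J <> unit_circle)
    (J_open : relatively_open (unit_circle) J) :
  exists G : set (ADJ J),
    [/\ Gdelta G, dense G &
        G `<=` [set f : ADJ J |
          nowhere_differentiable_on J (fun z => complex.Re (ADJ_fun f z)) /\
          nowhere_differentiable_on J (fun z => complex.Im (ADJ_fun f z))]].
Proof.
exists (\bigcap_i (@steep_set R J 1 i.+1 `&` steep_set (0 -i* 1) i.+1)); split.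
- eexists; last by reflexivity.
  by move=> i; apply: openI; apply: open_steep_set; rewrite ?normc1 ?normc_minus_i.
- exact: dense_steep.
- move=> f Gf; split.
    have := @steep_nowhere_differentiable R J 1 f J_sub J_proper J_open.
    have -> : (fun z => complex.Re (1 * ADJ_fun f z)) = (fun z => complex.Re (ADJ_fun f z)).
      by apply/funext => z; rewrite mul1r.
    by apply=> -[//|n] _; have [] := Gf n I.
  have := @steep_nowhere_differentiable R J (0 -i* 1) f J_sub J_proper J_open.
  have -> : (fun z => complex.Re ((0 -i* 1) * ADJ_fun f z)) = (fun z => complex.Im (ADJ_fun f z)).
    by apply/funext => z; rewrite Re_minus_i.
  by apply=> -[//|n] _; have [] := Gf n I.
Qed.
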